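(* Let $\{\mathbb{X}_n\}_{n\in\mathbb{N}}$ be a sequence of non-trivial normed linear spaces over $\mathbb{K}$. (i) For non-zero $x=\{x_n\}_{n\in\mathbb{N}}\in\bigoplus_1\mathbb{X}_n$, $f=\{f_n\}_{n\in\mathbb{N}}\in\bigoplus_\infty\mathbb{X}_n^*$ is a support functional of $x$ if and only if $f_n\in J(x_n)$ if $x_n\neq0$ and $\|f_n\|\le1$ if $x_n=0$. (ii) For non-zero $x=\{x_n\}_{n\in\mathbb{N}}\in\bigoplus_0\mathbb{X}_n$, $f=\{f_n\}_{n\in\mathbb{N}}\in\bigoplus_1\mathbb{X}_n^*$ is a support functional of $x$ if and only if $f_n\in\lambda_nJ(x_n)$ if $\|x_n\|=\|x\|_0$ and $f_n=0$ otherwise, such that $\lambda_n>0$ and $\sum_{\|x_n\|=\|x\|_0}\lambda_n=1$.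
   Context: $\mathbb{K}=\mathbb{R}$ or $\mathbb{C}$; non-trivial means of dimension more than $0$. $\bigoplus_1\mathbb{X}_n$, $\bigoplus_\infty\mathbb{X}_n$, $\bigoplus_0\mathbb{X}_n$ are the spaces of sequences $\{x_n\}$, $x_n\in\mathbb{X}_n$, with respectively $\sum_n\|x_n\|<\infty$, $\sup_n\|x_n\|<\infty$, $\lim_n\|x_n\|=0$, normed by $\|\{x_n\}\|_1=\sum_n\|x_n\|$, $\|\{x_n\}\|_\infty=\sup_n\|x_n\|$, $\|\{x_n\}\|_0=\max_n\|x_n\|$. The duals of $\bigoplus_1\mathbb{X}_n$ and $\bigoplus_0\mathbb{X}_n$ are identified isometrically with $\bigoplus_\infty\mathbb{X}_n^*$ and $\bigoplus_1\mathbb{X}_n^*$ respectively, via $f(x)=\sum_nf_n(x_n)$. For a non-zero $x$ in a normed space $\mathbb{X}$, a support functional of $x$ is an $f\in\mathbb{X}^*$ with $\|f\|=1$, $f(x)=\|x\|$; $J(x)$ is the set of all of them. In (ii) the numbers $\lambda_n$ are indexed by those $n$ with $\|x_n\|=\|x\|_0$.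
   Formalization: In (ii) the condition λ_n > 0 is replaced by λ_n ≥ 0, since the ''only if'' direction fails as printed: for x = (1,1,0,…), f = (1,0,0,…), f is a support functional of x but its second coordinate is 0. *)

(* Defs.v *)
From HB Require Import structures.
From mathcomp Require Import all_boot all_order all_algebra.
From mathcomp Require Import complex.
From mathcomp Require Import boolp classical_sets functions cardinality fsbigop.
From mathcomp Require Import reals topology normedtype sequences.
Set Implicit Arguments.
Unset Strict Implicit.
Unset Printing Implicit Defensive.
Import Order.TTheory GRing.Theory Num.Theory.
Import numFieldNormedType.Exports.
Local Open Scope classical_set_scope.
Local Open Scope ring_scope.

(* The two admissible scalar fields: R itself and the complex numbers R[i]. *)
Variant scalars := RealScalars | ComplexScalars.

Definition scalar_field (R : realType) (k : scalars) : numFieldType :=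
  match k with RealScalars => R | ComplexScalars => R[i] end.

Definition of_real (R : realType) (k : scalars) : R -> scalar_field R k :=
  match k with
  | RealScalars => fun x => x
  | ComplexScalars => fun x => x%:C%C
  end.

Definition real_part (R : realType) (k : scalars) : scalar_field R k -> R :=
  match k with
  | RealScalars => fun x => x
  | ComplexScalars => fun x => complex.Re x
  end.

Arguments of_real {R} k _.
Arguments real_part {R k} _.

(* The norm of the library takes its values in the scalar field; [rnorm] is the
   same norm with values in R, see [rnormE]. *)
Definition rnorm (R : realType) (k : scalars)
  (V : normedModType (scalar_field R k)) (v : V) : R := real_part `|v|.

Section scalar_field.
Variables (R : realType) (k : scalars).
Local Notation K := (scalar_field R k).
Local Notation ofR := (@of_real R k).
Implicit Types (V : normedModType K).

Lemma of_realB : {morph ofR : x y / x - y}.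
Proof. by case: k => //= x y; rewrite rmorphB. Qed.

Lemma of_realD : {morph ofR : x y / x + y}.
Proof. by case: k => //= x y; rewrite rmorphD. Qed.

Lemma of_realM : {morph ofR : x y / x * y}.
Proof. by case: k => //= x y; rewrite rmorphM. Qed.

Lemma of_real0 : ofR 0 = 0.
Proof. by case: k. Qed.

Lemma of_real1 : ofR 1 = 1.
Proof. by case: k. Qed.

Lemma of_realK : cancel ofR real_part.
Proof. by case: k. Qed.

Lemma ler_of_real : {mono ofR : x y / x <= y}.
Proof. by case: k => //= x y; rewrite lecR. Qed.

Lemma ltr_of_real : {mono ofR : x y / x < y}.
Proof. by case: k => //= x y; rewrite ltcR. Qed.

Lemma real_partK (x : K) : 0 <= x -> ofR (real_part x) = x.
Proof.
case: k x => //= -[a b]; rewrite lecE /= => /andP[/eqP b0 _].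
by rewrite b0.
Qed.

Lemma rnormE V (v : V) : ofR (rnorm v) = `|v|.
Proof. exact: real_partK. Qed.

Lemma rnorm_ge0 V (v : V) : 0 <= rnorm v.
Proof. by rewrite -ler_of_real of_real0 rnormE. Qed.

Lemma rnorm0 V : rnorm (0 : V) = 0.
Proof. by rewrite /rnorm normr0 -of_real0 of_realK. Qed.

Lemma rnorm0_eq0 V (v : V) : rnorm v = 0 -> v = 0.
Proof. by move=> v0; apply/normr0_eq0; rewrite -rnormE v0 of_real0. Qed.

Lemma rnormD V (v w : V) : rnorm (v + w) <= rnorm v + rnorm w.
Proof. by rewrite -ler_of_real of_realD !rnormE ler_normD. Qed.

Lemma rnormZ V (a : K) (v : V) : rnorm (a *: v) = rnorm (a : K^o) * rnorm v.
Proof.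
rewrite -[LHS]of_realK rnormE normrZ -(rnormE (a : K^o)) -rnormE.
by rewrite -of_realM of_realK.
Qed.

Lemma rnorm_of_real (x : R) : 0 <= x -> rnorm (ofR x : K^o) = x.
Proof.
by move=> x0; rewrite /rnorm ger0_norm ?of_realK// -of_real0 ler_of_real.
Qed.

End scalar_field.

Section series.
Variables (R : realType) (k : scalars).
Local Notation K := (scalar_field R k).
Local Notation ofR := (@of_real R k).

Lemma ge0_series_le (u v : R^nat) :
  (forall n, 0 <= u n <= v n) -> cvgn (series v) -> cvgn (series u).
Proof.
move=> uv; apply: series_le_cvg => n; have /andP[u0 ?] := uv n => //.
exact: le_trans u0 _.
Qed.

Lemma ge0_series_le_lim (u : R^nat) :
  (forall n, 0 <= u n) -> cvgn (series u) -> forall n, series u n <= limn (series u).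
Proof.
move=> u0 cu; apply: nondecreasing_cvgn_le => //.
by apply: nondecreasing_series => n _ _; exact: u0.
Qed.

Lemma rnorm_series_le (V : normedModType K) (u : V^nat) n :
  rnorm (series u n) <= series (fun i => rnorm (u i)) n.
Proof.
rewrite /series /=; elim: n => [|n ih]; first by rewrite !big_geq// rnorm0.
by rewrite !big_nat_recr//= (le_trans (rnormD _ _))// lerD2r.
Qed.

Lemma rnorm_lim_le (u : (K^o)^nat) (M : R) :
  cvgn u -> (forall n, rnorm (u n) <= M) -> rnorm (limn u : K^o) <= M.
Proof.
move=> cu uM; apply/ler_addgt0Pr => e e0.
have ge0 : 0 < ofR e by rewrite -(of_real0 R k) ltr_of_real.
have [N _ /(_ N (leqnn N))/= /ltW uN] := (@cvgrPdist_lt _ _ _ _ _ _ _).1 cu _ ge0.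
rewrite -(ler_of_real k) rnormE of_realD -[limn u](subrK (u N)) addrC.
by rewrite (le_trans (ler_normD _ _))// lerD// -rnormE ler_of_real.
Qed.

Lemma norm_of_real (x : R) : `|ofR x| = ofR `|x|.
Proof.
by case: k => //=; rewrite normc_def/= expr0n/= addr0 sqrtr_sqr.
Qed.

Lemma of_real_cvg (u : R^nat) (l : R) :
  u @ \oo --> l -> (fun n => ofR (u n) : K^o) @ \oo --> (ofR l : K^o).
Proof.
move=> ul; apply/cvgrPdist_lt => e e0.
have eE : e = ofR (real_part e) by rewrite real_partK// ltW.
have e'0 : 0 < real_part e by rewrite -(ltr_of_real k) -eE of_real0.
have [N _ uN] := (@cvgrPdist_lt _ _ _ _ _ _ _).1 ul _ e'0.
exists N => // n /uN /=; rewrite -(ltr_of_real k) -eE -of_realB.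
by rewrite -norm_of_real.
Qed.

End series.

Lemma abs_cvg_series (R : realType) (k : scalars) (u : ((scalar_field R k)^o)^nat) :
  cvgn (series (fun n => rnorm (u n))) -> cvgn (series u).
Proof.
case: k u => u cu; first exact: (@normed_cvg _ R).
have ReIm (p : R[i] -> R) : (forall z, `|p z| <= rnorm (z : (scalar_field R ComplexScalars)^o)) ->
    cvgn (series (fun n => p (u n))).
  move=> pz; apply: (@normed_cvg _ R); apply: ge0_series_le cu => n.
  by rewrite normr_ge0 pz.
have cRe : cvgn (series (fun n => complex.Re (u n))).
  apply: ReIm => -[a b]; rewrite /rnorm normc_def/= -sqrtr_sqr ler_sqrt ?lerDl ?sqr_ge0//.
  by rewrite addr_ge0// sqr_ge0.
have cIm : cvgn (series (fun n => complex.Im (u n))).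
  apply: ReIm => -[a b]; rewrite /rnorm normc_def/= -sqrtr_sqr ler_sqrt ?lerDr ?sqr_ge0//.
  by rewrite addr_ge0// sqr_ge0.
pose C := scalar_field R ComplexScalars.
pose c (v : R^nat) : (C^o)^nat := fun n => of_real ComplexScalars (v n).
have -> : series u = c (series (fun n => complex.Re (u n))) +
    ('i%C : C) *: c (series (fun n => complex.Im (u n))).
  apply/funext => n; rewrite /series /= -[RHS]/(_ + 'i%C * _) /c /=.
  elim: n => [|n ih]; first by rewrite !big_geq// rmorph0 mulr0 addr0.
  rewrite !big_nat_recr//= ih !rmorphD mulrDr addrACA; congr (_ + _).
  by case: (u n) => a b; rewrite /=; simpc.
apply: is_cvgD; first by apply: cvgP; apply: of_real_cvg cRe.
by apply: is_cvgZl_tmp; apply: cvgP; apply: of_real_cvg cIm.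
Qed.

Section dual.
Variables (R : realType) (k : scalars) (V : normedModType (scalar_field R k)).
Local Notation K := (scalar_field R k).
Local Notation ofR := (@of_real R k).

(* The continuous dual, as a subspace of the functions V -> K. *)
Definition dual_pred : {pred V -> K^o} :=
  [pred f : V -> K^o | `[< linear f /\ continuous f >] ].

Fact dual_submod_closed : submod_closed dual_pred.
Proof.
split=> [|a f g]; first by rewrite inE; split=> [b x y|]; [rewrite scaler0 addr0|exact: cst_continuous].
rewrite !inE => -[lf cf] [lg cg]; split=> [b x y|x].
  have E z : (a *: f + g) z = a * f z + g z by [].
  rewrite !E lf lg -[b *: f x]/(b * _) -[b *: g x]/(b * _) -[RHS]/(b * _ + _).
  by rewrite !mulrDr addrACA mulrCA.
by apply: continuousD => //; [apply: continuousZl_tmp => //; exact: cf|exact: cg].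
Qed.

HB.instance Definition _ :=
  GRing.isSubmodClosed.Build K (V -> K^o) dual_pred dual_submod_closed.

Record dual : predArgType := Dual {
  dual_fun :> V -> K^o;
  dual_funP : dual_fun \in dual_pred }.

HB.instance Definition _ := [isSub for dual_fun].
HB.instance Definition _ := [Choice of dual by <:].
HB.instance Definition _ := [SubChoice_isSubLmodule of dual by <:].

Lemma dual_linear (f : dual) : linear f.
Proof. by have := dual_funP f; rewrite inE => -[]. Qed.

HB.instance Definition _ (f : dual) :=
  GRing.isLinear.Build K V K^o *:%R f (dual_linear f).

Lemma dual_continuous (f : dual) : continuous f.
Proof. by have := dual_funP f; rewrite inE => -[]. Qed.

Lemma dual_bounded (f : dual) : exists M : R, forall x, rnorm (f x) <= M * rnorm x.
Proof.
have /linear_boundedP := continuous_linear_bounded 0 (@dual_continuous f 0).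
move=> [M [Mr fM]]; have M0 : 0 <= `|M| + 1 by rewrite addr_ge0.
exists (real_part (`|M| + 1)) => x.
rewrite -(ler_of_real k) of_realM !rnormE real_partK//; apply: fM.
by rewrite (le_lt_trans (real_ler_norm Mr))// ltrDl.
Qed.

Lemma bounded_in_dual (f : V -> K^o) (M : R) :
  linear f -> (forall x, rnorm (f x) <= M * rnorm x) -> f \in dual_pred.
Proof.
move=> lf fM; rewrite inE; split => //.
pose flin := GRing.isLinear.Build K V K^o *:%R f lf.
pose F : {linear V -> K^o} := HB.pack f flin.
apply: (@bounded_linear_continuous _ _ _ F); apply/linear_boundedP.
exists (ofR `|M|); split.
  by rewrite realE -(of_real0 R k) ler_of_real normr_ge0.
move=> r Mr x; have r0 : 0 <= r.
  by rewrite (le_trans _ (ltW Mr))// -(of_real0 R k) ler_of_real.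
rewrite (@le_trans _ _ (ofR M * `|x|))//; last first.
  rewrite ler_wpM2r// (le_trans _ (ltW Mr))// ler_of_real ler_norm//.
by rewrite -!rnormE -of_realM ler_of_real; exact: fM.
Qed.

(* The operator norm. *)
Definition dual_rnorm (f : dual) : R :=
  sup [set rnorm (f x) | x in [set x | rnorm x <= 1]].

Let dual_rnorm_ub (f : dual) :
  has_ubound [set rnorm (f x) | x in [set x | rnorm x <= 1]].
Proof.
have [M fM] := dual_bounded f; exists `|M| => _ [x /= x1 <-].
rewrite (le_trans (fM x))// (le_trans (ler_wpM2r (rnorm_ge0 _) (ler_norm _)))//.
by rewrite ler_piMr.
Qed.

Lemma dual_rnorm_ge0 (f : dual) : 0 <= dual_rnorm f.
Proof.
apply: ub_le_sup; first exact: dual_rnorm_ub.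
by exists 0 => /=; rewrite ?linear0 rnorm0.
Qed.

Lemma dual_le (f : dual) (x : V) : rnorm (f x) <= dual_rnorm f * rnorm x.
Proof.
have [->|x0] := eqVneq x 0; first by rewrite linear0 !rnorm0 mulr0.
have nx0 : 0 < rnorm x.
  by rewrite lt0r rnorm_ge0 andbT; apply: contra x0 => /eqP/rnorm0_eq0 ->.
pose a := (rnorm x)^-1.
have a0 : 0 <= a by rewrite invr_ge0 rnorm_ge0.
have : rnorm (f (ofR a *: x)) <= dual_rnorm f.
  apply: ub_le_sup; first exact: dual_rnorm_ub.
  by exists (ofR a *: x) => //=; rewrite rnormZ rnorm_of_real// mulVf// gt_eqF.
by rewrite linearZ/= rnormZ rnorm_of_real// mulrC ler_pdivrMr.
Qed.

Lemma dual_rnorm_le (f : dual) (M : R) : 0 <= M ->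
  (forall x, rnorm (f x) <= M * rnorm x) -> dual_rnorm f <= M.
Proof.
move=> M0 fM; apply: ge_sup.
  by exists (rnorm (f 0)), 0 => //=; rewrite rnorm0.
by move=> _ [x /= x1 <-]; rewrite (le_trans (fM x))// ler_piMr.
Qed.

Let dual_normD (f g : dual) :
  ofR (dual_rnorm (f + g)) <= ofR (dual_rnorm f) + ofR (dual_rnorm g).
Proof.
rewrite -of_realD ler_of_real dual_rnorm_le ?addr_ge0 ?dual_rnorm_ge0// => x.
by rewrite (le_trans (rnormD _ _))// mulrDl lerD// dual_le.
Qed.

Let dual_rnormZ_le (a : K) (f : dual) :
  dual_rnorm (a *: f) <= rnorm (a : K^o) * dual_rnorm f.
Proof.
rewrite dual_rnorm_le ?mulr_ge0 ?rnorm_ge0 ?dual_rnorm_ge0// => x.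
by rewrite (rnormZ a (f x)) -mulrA ler_wpM2l ?rnorm_ge0 ?dual_le.
Qed.

Let dual_normZ (a : K) (f : dual) :
  ofR (dual_rnorm (a *: f)) = `|a| * ofR (dual_rnorm f).
Proof.
rewrite -(rnormE (a : K^o)) -of_realM; congr ofR.
apply/eqP; rewrite eq_le dual_rnormZ_le/=.
have [->|a0] := eqVneq a 0; first by rewrite rnorm0 mul0r dual_rnorm_ge0.
rewrite -{1}[f](scalerK a0).
rewrite (le_trans (ler_wpM2l (rnorm_ge0 _) (dual_rnormZ_le _ _)))// mulrA.
by rewrite -rnormZ [_ *: _]divff// (_ : 1 = ofR 1) ?rnorm_of_real ?mul1r// of_real1.
Qed.

Let dual_norm0_eq0 (f : dual) : ofR (dual_rnorm f) = 0 -> f = 0.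
Proof.
rewrite -(of_real0 R k) => /(can_inj (@of_realK R k)) f0.
apply/val_inj/funext => x; apply: rnorm0_eq0; apply/eqP.
by rewrite eq_le rnorm_ge0 andbT (le_trans (dual_le _ _))// f0 mul0r.
Qed.

HB.instance Definition _ := Lmodule_isNormed.Build K dual
  dual_normD dual_normZ dual_norm0_eq0.

Lemma dual_normE (f : dual) : `|f : dual| = ofR (dual_rnorm f).
Proof. by []. Qed.

Definition support_functionals (x : V) : set dual :=
  [set f : dual | `|f| = 1 /\ f x = `|x|].

End dual.

Section direct_sums.
Variables (R : realType) (k : scalars) (X : nat -> normedModType (scalar_field R k)).
Local Notation K := (scalar_field R k).
Local Notation ofR := (@of_real R k).

Definition seq_product : Type := forall n, X n.

HB.instance Definition _ := gen_eqMixin seq_product.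
HB.instance Definition _ := gen_choiceMixin seq_product.

Let spadd (x y : seq_product) : seq_product := fun n => x n + y n.
Let spopp (x : seq_product) : seq_product := fun n => - x n.
Let spzero : seq_product := fun n => 0.
Let spscale (a : K) (x : seq_product) : seq_product := fun n => a *: x n.

Let spaddA : associative spadd.
Proof. by move=> x y z; apply/functional_extensionality_dep => n; exact: addrA. Qed.

Let spaddC : commutative spadd.
Proof. by move=> x y; apply/functional_extensionality_dep => n; exact: addrC. Qed.

Let spadd0 : left_id spzero spadd.
Proof. by move=> x; apply/functional_extensionality_dep => n; exact: add0r. Qed.

Let spaddN : left_inverse spzero spopp spadd.
Proof. by move=> x; apply/functional_extensionality_dep => n; exact: addNr. Qed.

HB.instance Definition _ :=
  GRing.isZmodule.Build seq_product spaddA spaddC spadd0 spaddN.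

Let spscaleA a b x : spscale a (spscale b x) = spscale (a * b) x.
Proof. by apply/functional_extensionality_dep => n; exact: scalerA. Qed.

Let spscale1 : left_id 1 spscale.
Proof. by move=> x; apply/functional_extensionality_dep => n; exact: scale1r. Qed.

Let spscaleDr : right_distributive spscale +%R.
Proof. by move=> a x y; apply/functional_extensionality_dep => n; exact: scalerDr. Qed.

Let spscaleDl x : {morph spscale^~ x : a b / a + b}.
Proof. by move=> a b; apply/functional_extensionality_dep => n; exact: scalerDl. Qed.

HB.instance Definition _ := GRing.Zmodule_isLmodule.Build K seq_product
  spscaleA spscale1 spscaleDr spscaleDl.

Definition seq_term (x : seq_product) n : X n := x n.
Coercion seq_term : seq_product >-> Funclass.

Definition term_norms (x : seq_product) : R^nat := fun n => rnorm (x n).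

Let term_norms0 : term_norms 0 = 0.
Proof. by apply/funext => n; exact: rnorm0. Qed.

Let term_normsDZ (a : K) (x y : seq_product) n :
  0 <= term_norms (a *: x + y) n <=
  (rnorm (a : K^o) *: term_norms x + term_norms y) n.
Proof.
by rewrite rnorm_ge0 (le_trans (rnormD _ _))// rnormZ.
Qed.

Definition l1_pred : {pred seq_product} :=
  [pred x | `[< cvgn (series (term_norms x)) >] ].
Definition linfty_pred : {pred seq_product} :=
  [pred x | `[< has_ubound (range (term_norms x)) >] ].
Definition c0_pred : {pred seq_product} :=
  [pred x | `[< term_norms x @ \oo --> 0 >] ].

Fact l1_submod_closed : submod_closed l1_pred.
Proof.
split=> [|a x y]; rewrite !inE.
  rewrite term_norms0; apply: (@cvgP _ _ 0).
  rewrite (_ : series _ = cst 0); first exact: cvg_cst.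
  by apply/funext => n; rewrite /series/= big1.
move=> cx cy; apply: ge0_series_le (term_normsDZ a x y) _.
by apply: is_cvg_seriesD => //; exact: is_cvg_seriesZ.
Qed.

Fact linfty_submod_closed : submod_closed linfty_pred.
Proof.
split=> [|a x y]; rewrite !inE.
  by exists 0 => _ [n _ <-]; rewrite term_norms0.
move=> [M xM] [N yN]; exists (rnorm (a : K^o) * M + N) => _ [n _ <-].
have /andP[_ /le_trans->//] := term_normsDZ a x y n.
by apply: lerD; [rewrite ler_wpM2l ?rnorm_ge0//; apply: xM|apply: yN]; exists n.
Qed.

Fact c0_submod_closed : submod_closed c0_pred.
Proof.
split=> [|a x y]; rewrite !inE; first by rewrite term_norms0; exact: cvg_cst.
move=> cx cy; apply: (@squeeze_cvgr _ _ _ _ (cst 0)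
    (rnorm (a : K^o) *: term_norms x + term_norms y)).
- by apply: nearW => n; exact: term_normsDZ.
- exact: cvg_cst.
- rewrite -[X in _ --> X]addr0 -[X in _ --> X + _](scaler0 _ (rnorm (a : K^o))).
  by apply: cvgD => //; exact: cvgZl_tmp.
Qed.

HB.instance Definition _ :=
  GRing.isSubmodClosed.Build K seq_product l1_pred l1_submod_closed.
HB.instance Definition _ :=
  GRing.isSubmodClosed.Build K seq_product linfty_pred linfty_submod_closed.
HB.instance Definition _ :=
  GRing.isSubmodClosed.Build K seq_product c0_pred c0_submod_closed.

(* The l^1, l^infty and c_0 direct sums of the family X. *)
Record l1_sum : predArgType := L1Sum {
  l1_val :> seq_product; l1_valP : l1_val \in l1_pred }.
HB.instance Definition _ := [isSub for l1_val].
HB.instance Definition _ := [Choice of l1_sum by <:].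
HB.instance Definition _ := [SubChoice_isSubLmodule of l1_sum by <:].

Record linfty_sum : predArgType := LinftySum {
  linfty_val :> seq_product; linfty_valP : linfty_val \in linfty_pred }.
HB.instance Definition _ := [isSub for linfty_val].
HB.instance Definition _ := [Choice of linfty_sum by <:].
HB.instance Definition _ := [SubChoice_isSubLmodule of linfty_sum by <:].

Record c0_sum : predArgType := C0Sum {
  c0_val :> seq_product; c0_valP : c0_val \in c0_pred }.
HB.instance Definition _ := [isSub for c0_val].
HB.instance Definition _ := [Choice of c0_sum by <:].
HB.instance Definition _ := [SubChoice_isSubLmodule of c0_sum by <:].

Lemma l1_cvg (x : l1_sum) : cvgn (series (term_norms x)).
Proof. by have := l1_valP x; rewrite inE. Qed.

Lemma linfty_bounded (x : linfty_sum) : has_ubound (range (term_norms x)).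
Proof. by have := linfty_valP x; rewrite inE. Qed.

Lemma c0_cvg (x : c0_sum) : term_norms x @ \oo --> 0.
Proof. by have := c0_valP x; rewrite inE. Qed.

Lemma c0_bounded (x : c0_sum) : has_ubound (range (term_norms x)).
Proof.
have /cvg_has_ub[M xM] : cvgn (term_norms x) by apply: cvgP (@c0_cvg x).
exists M => _ [n _ <-]; apply: le_trans (ler_norm _) _.
by apply: xM; exists n.
Qed.

Definition l1_rnorm (x : l1_sum) : R := limn (series (term_norms x)).
Definition linfty_rnorm (x : linfty_sum) : R := sup (range (term_norms x)).
(* This supremum is a maximum, see [c0_rnorm_max]. *)
Definition c0_rnorm (x : c0_sum) : R := sup (range (term_norms x)).

Lemma l1_rnorm_ge (x : l1_sum) n : term_norms x n <= l1_rnorm x.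
Proof.
have ge0 i : 0 <= term_norms x i by exact: rnorm_ge0.
apply: le_trans (ge0_series_le_lim ge0 (@l1_cvg x) n.+1).
by rewrite /series/= big_nat_recr//= lerDr sumr_ge0.
Qed.

Lemma linfty_rnorm_ge (x : linfty_sum) n : term_norms x n <= linfty_rnorm x.
Proof. by apply: ub_le_sup; [exact: linfty_bounded|exists n]. Qed.

Lemma c0_rnorm_ge (x : c0_sum) n : term_norms x n <= c0_rnorm x.
Proof. by apply: ub_le_sup; [exact: c0_bounded|exists n]. Qed.

Lemma c0_rnorm_max (x : c0_sum) : exists n, term_norms x n = c0_rnorm x.
Proof.
apply: contrapT => /forallNP nx.
have lt n : term_norms x n < c0_rnorm x.
  by rewrite lt_neqAle c0_rnorm_ge andbT; apply/eqP/nx.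
have x0 : 0 < c0_rnorm x by apply: le_lt_trans (lt 0%N); exact: rnorm_ge0.
have [N _ xN] := (@cvgrPdist_lt _ _ _ _ _ _ _).1 (@c0_cvg x) _ (divr_gt0 x0 (ltr0n _ 2)).
pose M := Num.max (c0_rnorm x / 2) (\big[Num.max/0]_(i < N) term_norms x i).
have : c0_rnorm x <= M.
  apply: ge_sup; first by exists (term_norms x 0%N), 0%N.
  move=> _ [n _ <-]; rewrite le_max.
  have [Nn|nN] := leqP N n.
    have /ltW := xN _ Nn.
    by rewrite /= sub0r normrN ger0_norm ?rnorm_ge0// => ->.
  by apply/orP; right; rewrite (le_bigmax _ _ (Ordinal nN)).
rewrite leNgt gt_max ltr_pdivrMr// ltr_pMr// ltr1n/=.
by rewrite bigmax_lt.
Qed.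

Let l1_normD (x y : l1_sum) :
  ofR (l1_rnorm (x + y)) <= ofR (l1_rnorm x) + ofR (l1_rnorm y).
Proof.
rewrite -of_realD ler_of_real /l1_rnorm -lim_seriesD; try exact: l1_cvg.
apply: lim_series_le => [||n]; [exact: l1_cvg|by apply: is_cvg_seriesD; exact: l1_cvg|].
exact: rnormD.
Qed.

Let l1_normZ (a : K) (x : l1_sum) :
  ofR (l1_rnorm (a *: x)) = `|a| * ofR (l1_rnorm x).
Proof.
rewrite -(rnormE (a : K^o)) -of_realM; congr ofR.
rewrite /l1_rnorm -[RHS](lim_seriesZ _ (@l1_cvg x)); congr (limn (series _)).
by apply/funext => n; exact: rnormZ.
Qed.

Let l1_norm0_eq0 (x : l1_sum) : ofR (l1_rnorm x) = 0 -> x = 0.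
Proof.
rewrite -(of_real0 R k) => /(can_inj (@of_realK R k)) x0.
apply/val_inj/functional_extensionality_dep => n; apply: rnorm0_eq0; apply/eqP.
by rewrite eq_le rnorm_ge0 andbT -x0 l1_rnorm_ge.
Qed.

HB.instance Definition _ := Lmodule_isNormed.Build K l1_sum
  l1_normD l1_normZ l1_norm0_eq0.

Let sup_termD (x y z : seq_product) : x = y + z ->
  has_ubound (range (term_norms y)) -> has_ubound (range (term_norms z)) ->
  sup (range (term_norms x)) <= sup (range (term_norms y)) + sup (range (term_norms z)).
Proof.
move=> -> yb zb; apply: ge_sup => [|_ [n _ <-]]; first by exists (term_norms (y + z) 0%N), 0%N.
by rewrite (le_trans (rnormD _ _))// lerD//; apply: ub_le_sup => //; exists n.
Qed.

Let sup_termZ_le (a : K) (x : seq_product) : has_ubound (range (term_norms x)) ->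
  sup (range (term_norms (a *: x))) <= rnorm (a : K^o) * sup (range (term_norms x)).
Proof.
move=> xb; apply: ge_sup => [|_ [n _ <-]]; first by exists (term_norms (a *: x) 0%N), 0%N.
by rewrite /term_norms rnormZ ler_wpM2l ?rnorm_ge0//; apply: ub_le_sup => //; exists n.
Qed.

Let sup_termZ (a : K) (x : seq_product) :
  has_ubound (range (term_norms x)) -> has_ubound (range (term_norms (a *: x))) ->
  sup (range (term_norms (a *: x))) = rnorm (a : K^o) * sup (range (term_norms x)).
Proof.
move=> xb axb; apply/eqP; rewrite eq_le sup_termZ_le//=.
have [->|a0] := eqVneq a 0.
  rewrite rnorm0 mul0r; apply: (@le_trans _ _ (term_norms (0 *: x) 0%N)); first exact: rnorm_ge0.
  apply: ub_le_sup; last by exists 0%N.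
  by rewrite scale0r term_norms0; exists 0 => _ [n _ <-].
rewrite -{1}[x](scalerK a0).
rewrite (le_trans (ler_wpM2l (rnorm_ge0 _) (sup_termZ_le _ _)))// mulrA.
by rewrite -rnormZ [_ *: _]divff// (_ : 1 = ofR 1) ?rnorm_of_real ?mul1r// of_real1.
Qed.

Let linfty_normD (x y : linfty_sum) :
  ofR (linfty_rnorm (x + y)) <= ofR (linfty_rnorm x) + ofR (linfty_rnorm y).
Proof.
by rewrite -of_realD ler_of_real; apply: sup_termD => //; exact: linfty_bounded.
Qed.

Let linfty_normZ (a : K) (x : linfty_sum) :
  ofR (linfty_rnorm (a *: x)) = `|a| * ofR (linfty_rnorm x).
Proof.
rewrite -(rnormE (a : K^o)) -of_realM; congr ofR.
by apply: sup_termZ; [exact: linfty_bounded|exact: (linfty_bounded (a *: x))].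
Qed.

Let linfty_norm0_eq0 (x : linfty_sum) : ofR (linfty_rnorm x) = 0 -> x = 0.
Proof.
rewrite -(of_real0 R k) => /(can_inj (@of_realK R k)) x0.
apply/val_inj/functional_extensionality_dep => n; apply: rnorm0_eq0; apply/eqP.
by rewrite eq_le rnorm_ge0 andbT -x0 linfty_rnorm_ge.
Qed.

HB.instance Definition _ := Lmodule_isNormed.Build K linfty_sum
  linfty_normD linfty_normZ linfty_norm0_eq0.

Let c0_normD (x y : c0_sum) :
  ofR (c0_rnorm (x + y)) <= ofR (c0_rnorm x) + ofR (c0_rnorm y).
Proof.
by rewrite -of_realD ler_of_real; apply: sup_termD => //; exact: c0_bounded.
Qed.

Let c0_normZ (a : K) (x : c0_sum) :
  ofR (c0_rnorm (a *: x)) = `|a| * ofR (c0_rnorm x).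
Proof.
rewrite -(rnormE (a : K^o)) -of_realM; congr ofR.
by apply: sup_termZ; [exact: c0_bounded|exact: (c0_bounded (a *: x))].
Qed.

Let c0_norm0_eq0 (x : c0_sum) : ofR (c0_rnorm x) = 0 -> x = 0.
Proof.
rewrite -(of_real0 R k) => /(can_inj (@of_realK R k)) x0.
apply/val_inj/functional_extensionality_dep => n; apply: rnorm0_eq0; apply/eqP.
by rewrite eq_le rnorm_ge0 andbT -x0 c0_rnorm_ge.
Qed.

HB.instance Definition _ := Lmodule_isNormed.Build K c0_sum
  c0_normD c0_normZ c0_norm0_eq0.

Lemma l1_normE (x : l1_sum) : `|x : l1_sum| = ofR (l1_rnorm x).
Proof. by []. Qed.

Lemma linfty_normE (x : linfty_sum) : `|x : linfty_sum| = ofR (linfty_rnorm x).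
Proof. by []. Qed.

Lemma c0_normE (x : c0_sum) : `|x : c0_sum| = ofR (c0_rnorm x).
Proof. by []. Qed.

End direct_sums.

Section pairing.
Variables (R : realType) (k : scalars) (X : nat -> normedModType (scalar_field R k)).
Local Notation K := (scalar_field R k).
Local Notation ofR := (@of_real R k).
Local Notation X' := (fun n => dual (X n)).

(* The value sum_n f_n(x_n). The series converges in both of the cases where the
   pairing is bundled into a functional below, see [linfty_l1_le], [l1_c0_le]. *)
Definition pairing (f : seq_product X') (x : seq_product X) : K^o :=
  limn (series (fun n => f n (x n))).

Let termE (V : normedModType K) (g : dual V) : rnorm g = dual_rnorm g.
Proof. exact: of_realK. Qed.

Let term_le (f : seq_product X') (x : seq_product X) n :
  rnorm (f n (x n)) <= term_norms f n * term_norms x n.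
Proof. by rewrite [term_norms f n]termE dual_le. Qed.

Let pairing_linear (f : seq_product X') (V : lmodType K)
    (i : {linear V -> seq_product X}) :
  (forall x, cvgn (series (fun n => f n (i x n)))) -> linear (fun x => pairing f (i x)).
Proof.
move=> cf a x y; rewrite /pairing -[a *: limn _](lim_seriesZ _ (cf x)).
rewrite -lim_seriesD//; last exact: is_cvg_seriesZ.
congr (limn (series _)); apply/funext => n.
by rewrite linearP; exact: linearP.
Qed.

Let pairing_le (f : seq_product X') (x : seq_product X) (u : R^nat) :
    (forall n, rnorm (f n (x n)) <= u n) -> cvgn (series u) ->
  cvgn (series (fun n => f n (x n))) /\ rnorm (pairing f x) <= limn (series u).
Proof.
move=> fu cu.
have cfx : cvgn (series (fun n => rnorm (f n (x n)))).
  by apply: ge0_series_le cu => n; rewrite rnorm_ge0 fu.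
have cf := abs_cvg_series cfx; split => //; apply: rnorm_lim_le => // n.
apply: le_trans (rnorm_series_le _ _) _.
apply: (@le_trans _ _ (series u n)); first by apply: ler_sum => i _; exact: fu.
by apply: ge0_series_le_lim => // i; exact: le_trans (rnorm_ge0 _) (fu i).
Qed.

Lemma linfty_l1_le (f : linfty_sum X') (x : l1_sum X) :
  cvgn (series (fun n => f n (x n))) /\
  rnorm (pairing f x) <= linfty_rnorm f * rnorm x.
Proof.
have -> : linfty_rnorm f * rnorm x =
    limn (series (linfty_rnorm f *: term_norms x)).
  rewrite (lim_seriesZ _ (l1_cvg (x := x))); congr (_ * _); exact: of_realK.
apply: pairing_le => [n|]; last by apply: is_cvg_seriesZ; exact: l1_cvg.
apply: le_trans (term_le _ _ _) _.
by rewrite ler_wpM2r ?rnorm_ge0// linfty_rnorm_ge.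
Qed.

Lemma l1_c0_le (f : l1_sum X') (x : c0_sum X) :
  cvgn (series (fun n => f n (x n))) /\
  rnorm (pairing f x) <= l1_rnorm f * rnorm x.
Proof.
have -> : l1_rnorm f * rnorm x =
    limn (series (rnorm x *: term_norms f)).
  by rewrite (lim_seriesZ _ (l1_cvg (x := f))) mulrC.
apply: pairing_le => [n|]; last by apply: is_cvg_seriesZ; exact: l1_cvg.
apply: le_trans (term_le _ _ _) _.
rewrite mulrC ler_wpM2r ?rnorm_ge0// (_ : rnorm x = c0_rnorm x) ?c0_rnorm_ge//.
exact: of_realK.
Qed.

Fact linfty_functional_subproof (f : linfty_sum X') :
  (fun x : l1_sum X => pairing f x) \in @dual_pred R k (l1_sum X).
Proof.
apply: (bounded_in_dual (M := linfty_rnorm f)) => [|x]; last by case: (linfty_l1_le f x).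
by apply: (pairing_linear (i := val)) => x; case: (linfty_l1_le f x).
Qed.

Fact l1_functional_subproof (f : l1_sum X') :
  (fun x : c0_sum X => pairing f x) \in @dual_pred R k (c0_sum X).
Proof.
apply: (bounded_in_dual (M := l1_rnorm f)) => [|x]; last by case: (l1_c0_le f x).
by apply: (pairing_linear (i := val)) => x; case: (l1_c0_le f x).
Qed.

(* The functionals represented by the elements of the sums of the duals. *)
Definition linfty_functional (f : linfty_sum X') : dual (l1_sum X) :=
  Dual (linfty_functional_subproof f).

Definition l1_functional (f : l1_sum X') : dual (c0_sum X) :=
  Dual (l1_functional_subproof f).

End pairing.

(* Main.v *)
Require Import Defs.
From mathcomp Require Import all_boot all_order all_algebra.
From mathcomp Require Import complex.
From mathcomp Require Import boolp classical_sets functions cardinality fsbigop.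
From mathcomp Require Import reals topology normedtype sequences.
From mathcomp Require Import ring lra.
Set Implicit Arguments.
Unset Strict Implicit.
Unset Printing Implicit Defensive.
Import Order.TTheory GRing.Theory Num.Theory.
Import numFieldNormedType.Exports.
Local Open Scope classical_set_scope.
Local Open Scope ring_scope.

(* The functionals represented by linfty and l1 sequences have norm sup_n |f_n|
   and sum_n |f_n|, so f supports x iff this norm is at most 1 and
   sum_n f_n(x_n) = |x|.  Then equality holds in each of the termwise estimates
   |f_n(x_n)| <= |x_n|, resp. |f_n(x_n)| <= |f_n| |x|, which gives the coordinate
   conditions, with lambda_n = |f_n| in the second case.  A coordinate with
   f_n = 0 and |x_n| = |x| lies in 0 J(x_n) only because J(x_n) is nonempty;
   this is the Hahn-Banach theorem, obtained here from a minimal sublinear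
   functional below the norm. *)

(** * Sublinear functionals *)

Section inf_bounds.
Variable R : realType.
Implicit Types A B : set R.

Lemma le_infD A B (c : R) : A !=set0 -> B !=set0 ->
  (forall a b, A a -> B b -> c <= a + b) -> c <= inf A + inf B.
Proof.
move=> A0 B0 cAB; rewrite -lerBlDr; apply: lb_le_inf => // a Aa.
rewrite lerBlDr -lerBlDl; apply: lb_le_inf => // b Bb.
by rewrite lerBlDl cAB.
Qed.

Lemma le_infZ A (t c : R) : A !=set0 -> 0 <= t ->
  (forall a, A a -> c <= t * a) -> c <= t * inf A.
Proof.
move=> [a Aa]; rewrite [0 <= t]le_eqVlt => /orP[/eqP<- cA|t0 cA].
  by rewrite mul0r -(mul0r a) cA.
rewrite mulrC -ler_pdivrMr//; apply: lb_le_inf; first by exists a.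
by move=> b Ab; rewrite ler_pdivrMr// mulrC cA.
Qed.

End inf_bounds.

Section sublinear.
Variables (R : realType) (k : scalars) (V : lmodType (scalar_field R k)).
Local Notation ofR := (@of_real R k).
Implicit Types (p q : V -> R) (A : set (V -> R)).

(** Homogeneity is asked only as an inequality, which passes easily to infima; [sublinearZ] recovers
    equality, for t > 0 by scaling back with the inverse. *)
Definition sublinear p :=
  (forall x y, p (x + y) <= p x + p y) /\
  (forall t x, 0 <= t -> p (ofR t *: x) <= t * p x).

Lemma sublinearZ p t x : sublinear p -> 0 <= t -> p (ofR t *: x) = t * p x.
Proof.
move=> [pD pZ] t0; apply/eqP; rewrite eq_le pZ//=.
move: t0; rewrite [0 <= t]le_eqVlt => /orP[/eqP<-|t0].
  (* At t = 0, subadditivity at 0 gives p(0) <= 2 p(0), hence 0 <= p(0). *)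
  have := pD 0 0; rewrite addr0 of_real0 scale0r mul0r; lra.
have tN0 : t != 0 by rewrite gt_eqF.
rewrite mulrC -ler_pdivlMr// mulrC -{1}[x]scale1r -(of_real1 R k) -(mulVf tN0).
by rewrite of_realM -scalerA pZ// invr_ge0 ltW.
Qed.

Lemma sublinear0 p : sublinear p -> p 0 = 0.
Proof. by move=> /sublinearZ/(_ (lexx 0)) => /(_ 0); rewrite scaler0 mul0r. Qed.

Lemma sublinearN p x : sublinear p -> - p (- x) <= p x.
Proof.
move=> sp; have [pD _] := sp.
by have := pD x (- x); rewrite subrr sublinear0//; lra.
Qed.

(** A sum or multiple need only be dominated by some member of [A], possibly a different one. This
    covers both the family defining [linearize_at] and the chains in Zorn's lemma. *)
Lemma inf_sublinear A : A !=set0 ->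
    (forall x, has_lbound [set q x | q in A]) ->
    (forall q r x y, A q -> A r -> exists2 s, A s & s (x + y) <= q x + r y) ->
    (forall q t x, A q -> 0 <= t -> exists2 s, A s & s (ofR t *: x) <= t * q x) ->
  sublinear (fun x => inf [set q x | q in A]).
Proof.
move=> [q Aq] lbA AD AZ.
have A0 x : [set q x | q in A] !=set0 by exists (q x), q.
split=> [x y|t x t0].
  apply: le_infD => // _ _ [r Ar <-] [s As <-].
  have [u Au /(le_trans _)->//] := AD _ _ x y Ar As.
  by apply: ge_inf => //; exists u.
apply: le_infZ => // _ [r Ar <-].
have [u Au /(le_trans _)->//] := AZ _ _ x Ar t0.
by apply: ge_inf => //; exists u.
Qed.

(* A sublinear minorant of [p] that is linear along [y]. A minimal sublinear
   functional equals all of these, hence is linear. *)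
Definition linearize_at p (y x : V) : R :=
  inf [set p (x + ofR t *: y) - t * p y | t in [set t | 0 <= t]].

Section linearize_at.
Variables (p : V -> R) (y : V).
Hypothesis sp : sublinear p.

(** Subadditivity is applied to t y = (x + t y) - x. The bound does not depend on t, so the infimum
    is finite. *)
Let lb x : lbound [set p (x + ofR t *: y) - t * p y | t in [set t | 0 <= t]]
  (- p (- x)).
Proof.
move=> _ [t /= t0 <-].
have := sp.1 (x + ofR t *: y) (- x).
by rewrite addrC addKr sublinearZ//; lra.
Qed.

Lemma linearize_at_le x t : 0 <= t ->
  linearize_at p y x <= p (x + ofR t *: y) - t * p y.
Proof. by move=> t0; apply: ge_inf; [exists (- p (- x)); exact: lb|exists t]. Qed.

Lemma linearize_at_sublinear : sublinear (linearize_at p y).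
Proof.
pose g t x : R := p (x + ofR t *: y) - t * p y.
have -> : linearize_at p y =
    fun x => inf [set q x | q in [set g t | t in [set t | 0 <= t]]].
  by apply/funext => x; rewrite /linearize_at image_comp.
apply: inf_sublinear.
- by exists (g 0), 0 => /=.
- by move=> x; exists (- p (- x)) => _ [_ [t t0 <-] <-]; apply: lb; exists t.
(* The members with parameters s and t are combined in the one with parameter s + t; below, scaling
   by t turns s into t s. *)
- move=> _ _ u v [s /= s0 <-] [t /= t0 <-]; exists (g (s + t)).
    by exists (s + t) => //=; exact: addr_ge0.
  rewrite /g of_realD scalerDl addrACA.
  have := sp.1 (u + ofR s *: y) (v + ofR t *: y); lra.
- move=> _ t u [s /= s0 <-] t0; exists (g (t * s)).
    by exists (t * s) => //=; exact: mulr_ge0.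
  rewrite /g of_realM -scalerA -scalerDr sublinearZ//; lra.
Qed.

End linearize_at.

(** Zorn's lemma on the sublinear functionals below p: a nonempty chain is bounded below by its
    pointwise infimum. *)
Lemma exists_minimal_sublinear p : sublinear p ->
  exists2 q, sublinear q /\ (forall x, q x <= p x) &
    forall r, sublinear r -> (forall x, r x <= q x) -> r = q.
Proof.
move=> sp.
pose T := {q : V -> R | sublinear q /\ forall x, q x <= p x}.
(* The order is reversed, so that a maximal element is a minimal functional. *)
pose le (s t : T) := `[< forall x, sval t x <= sval s x >].
have inj (s t : T) : sval s = sval t -> s = t.
  by case: s t => [s s1] [t t1] /= st; exact/eq_exist.
have [||||[q [sq qp]] qmin] := @Zorn T le.
- by move=> s; apply/asboolP.
- move=> r s t /asboolP rs /asboolP st; apply/asboolP => x.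
  exact: le_trans (st x) (rs x).
- move=> s t /asboolP st /asboolP ts; apply/inj/funext => x.
  by apply/eqP; rewrite eq_le st ts.
- move=> A tot; have [A0|/set0P/negP/negPn/eqP A0] := pselect (A !=set0); last first.
    have pT : sublinear p /\ forall x, p x <= p x by [].
    by exists (exist _ p pT) => s; rewrite A0.
  pose B := [set sval s | s in A].
  (* Every sublinear q below p satisfies -p(-x) <= -q(-x) <= q(x). *)
  have lbB x : lbound [set q x | q in B] (- p (- x)).
    move=> _ [_ [[q [sq qp]] _ <-] <-] /=.
    by apply: le_trans (sublinearN x sq); rewrite lerN2.
  pose b x := inf [set q x | q in B].
  have sB : sublinear b.
    apply: inf_sublinear.
    + by case: A0 => s As; exists (sval s), s.
    + by move=> x; exists (- p (- x)).
    (* Of two comparable functionals, the smaller one serves for the sum. *)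
    + move=> _ _ x y [s As <-] [t At <-].
      have [/asboolP le_st|/asboolP le_ts] := tot _ _ As At.
      * exists (sval t); first by exists t.
        by apply: le_trans ((svalP t).1.1 _ _) _; rewrite lerD2r.
      * exists (sval s); first by exists s.
        by apply: le_trans ((svalP s).1.1 _ _) _; rewrite lerD2l.
    + move=> _ t x [s As <-] t0; exists (sval s); first by exists s.
      exact: (svalP s).1.2.
  have leB s x : A s -> b x <= sval s x.
    move=> As; apply: ge_inf; first by exists (- p (- x)).
    by exists (sval s) => //; exists s.
  have pB x : b x <= p x.
    by case: A0 => s As; apply: le_trans (leB s x As) ((svalP s).2 x).
  have bT : sublinear b /\ forall x, b x <= p x by [].
  by exists (exist _ b bT) => s As; apply/asboolP => x; exact: leB.
- exists q => // r sr rq.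
  have rp x : r x <= p x by exact: le_trans (rq x) (qp x).
  have rT : sublinear r /\ forall x, r x <= p x by [].
  suff /(congr1 sval) : exist _ r rT = exist _ q (conj sq qp) :> T by [].
  by apply: qmin; apply/asboolP.
Qed.

Lemma sublinear_dominates_linear p : sublinear p ->
  exists f : V -> R, [/\ {morph f : x y / x + y},
    forall t x, f (ofR t *: x) = t * f x & forall x, f x <= p x].
Proof.
move=> /exists_minimal_sublinear[f [sf fp] fmin].
have fD : {morph f : x y / x + y}.
  move=> x y; apply/eqP; rewrite eq_le sf.1 /=.
  have fy : linearize_at f y = f.
    apply: fmin => [|z]; first exact: linearize_at_sublinear.
    have := linearize_at_le y sf z (lexx 0).
    by rewrite of_real0 scale0r addr0 mul0r subr0.
  (* With t = 1 this becomes f(x) <= f(x + y) - f(y), the converse of subadditivity. *)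
  have := linearize_at_le y sf x ler01.
  by rewrite fy of_real1 scale1r mul1r lerBrDr.
have fN x : f (- x) = - f x.
  by apply/eqP; rewrite -addr_eq0 -fD addNr (sublinear0 sf).
exists f; split => // t x; have [t0|t0] := leP 0 t; first exact: sublinearZ.
have -> : ofR t *: x = - (ofR (- t) *: x).
  by rewrite -scaleNr -[- t]sub0r of_realB of_real0 sub0r opprK.
by rewrite fN sublinearZ// ?oppr_ge0 ?ltW// mulNr opprK.
Qed.

End sublinear.

(** * Scalars, series and support functionals *)

Section scalars.
Variables (R : realType) (k : scalars).
Local Notation K := (scalar_field R k).
Local Notation ofR := (@of_real R k).

Lemma real_partD : {morph @real_part R k : z w / z + w}.
Proof. by case: k => //= z w; rewrite raddfD. Qed.

Lemma real_partB : {morph @real_part R k : z w / z - w}.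
Proof. by case: k => //= z w; rewrite raddfB. Qed.

Lemma real_part_le_rnorm (z : K) : `|real_part z| <= rnorm (z : K^o).
Proof.
case: k z => [z|[a b]]; first exact: lexx.
rewrite /rnorm normc_def/= -sqrtr_sqr.
by rewrite ler_sqrt ?lerDl ?sqr_ge0// addr_ge0// sqr_ge0.
Qed.

(** Here a = Re z must equal r, and a^2 + b^2 <= a^2 leaves no imaginary part b. This turns equality
    in an estimate into an exact value. *)
Lemma eq_of_real (z : K) (r : R) :
  rnorm (z : K^o) <= r -> r <= real_part z -> z = ofR r.
Proof.
move=> zr rz; have zE : real_part z = r.
  apply/eqP; rewrite eq_le rz andbT.
  exact: le_trans (ler_norm _) (le_trans (real_part_le_rnorm z) zr).
have r0 : 0 <= r := le_trans (rnorm_ge0 _) zr.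
case: k z zr zE {rz} => [//|[a b]]; rewrite /rnorm normc_def/= => zr ar.
congr (_ +i* _)%C => //; apply/eqP; rewrite -sqrf_eq0 eq_le sqr_ge0 andbT.
by rewrite -(lerD2l (a ^+ 2)) addr0 {2}ar -ler_sqrt ?sqr_ge0// sqrtr_sqr ger0_norm.
Qed.

Lemma rnorm_gt0 (V : normedModType K) (v : V) : v != 0 -> 0 < rnorm v.
Proof.
by move=> v0; rewrite lt0r rnorm_ge0 andbT; apply: contra v0 => /eqP/rnorm0_eq0 ->.
Qed.

Lemma exists_phase (z : K) : exists2 u : K, rnorm (u : K^o) = 1 & u * z = `|z|.
Proof.
have [->|z0] := eqVneq z 0.
  by exists 1; rewrite /rnorm ?normr1 ?mulr0 ?normr0// -(of_real1 R k) of_realK.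
exists (`|z| / z); last by rewrite divfK.
by rewrite /rnorm normf_div normr_id divff ?normr_eq0// -(of_real1 R k) of_realK.
Qed.

Lemma real_part_cvg (u : (K^o)^nat) (l : K^o) :
  u @ \oo --> l -> (fun n => real_part (u n)) @ \oo --> real_part l.
Proof.
move=> ul; apply/cvgrPdist_lt => e e0.
have ge0 : 0 < ofR e by rewrite -(of_real0 R k) ltr_of_real.
have [N _ uN] := (@cvgrPdist_lt _ _ _ _ _ _ _).1 ul _ ge0.
exists N => // n /uN /=; rewrite -rnormE ltr_of_real -real_partB.
exact: le_lt_trans (real_part_le_rnorm _).
Qed.

Lemma series_of_real (v : R^nat) :
  series (fun n => ofR (v n) : K^o) = fun n => ofR (series v n).
Proof.
apply/funext => n; rewrite /series /=.
by apply/esym/(big_morph ofR (@of_realD R k) (of_real0 R k)).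
Qed.

Lemma series_real_part (u : (K^o)^nat) :
  series (fun n => real_part (u n)) = fun n => real_part (series u n).
Proof.
apply/funext => n; rewrite /series /=; apply/esym/(big_morph _ real_partD).
by rewrite -(of_real0 R k) of_realK.
Qed.

Lemma lim_series_of_real (v : R^nat) : cvgn (series v) ->
  limn (series (fun n => ofR (v n) : K^o)) = ofR (limn (series v)).
Proof.
move=> cv; rewrite series_of_real; apply/cvg_lim; first exact: norm_hausdorff.
exact: of_real_cvg.
Qed.

Lemma ge0_series_lim_eq0 (w : R^nat) : (forall n, 0 <= w n) ->
  cvgn (series w) -> limn (series w) <= 0 -> forall n, w n = 0.
Proof.
move=> w0 cw lw n; apply/eqP; rewrite eq_le w0 andbT.
apply: le_trans lw; apply: le_trans (ge0_series_le_lim w0 cw n.+1).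
by rewrite /series/= big_nat_recr//= lerDr sumr_ge0.
Qed.

(** The equality case of the triangle inequality for series: the terms v_n - Re u_n are nonnegative
    with sum at most 0, so all vanish. *)
Lemma series_eq_of_real (u : (K^o)^nat) (v : R^nat) :
    (forall n, rnorm (u n) <= v n) -> cvgn (series u) -> cvgn (series v) ->
    limn (series v) <= real_part (limn (series u)) ->
  forall n, u n = ofR (v n).
Proof.
move=> uv cu cv lvu.
have rv n : real_part (u n) <= v n.
  by rewrite (le_trans (ler_norm _))// (le_trans (real_part_le_rnorm _)).
pose w : R^nat := fun n => v n - real_part (u n).
have sw : series w @ \oo --> limn (series v) - real_part (limn (series u)).
  have -> : series w = series v - series (fun n => real_part (u n)).
    by apply/funext => n; rewrite /series /= sumrB.
  by apply: cvgB => //; rewrite series_real_part; exact: real_part_cvg.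
have w0 n : w n = 0.
  apply: ge0_series_lim_eq0 => [m||]; first by rewrite subr_ge0.
    exact: cvgP sw.
  by rewrite (cvg_lim _ sw)// subr_le0.
move=> n; apply: eq_of_real => //; have /eqP := w0 n.
by rewrite subr_eq0 => /eqP ->.
Qed.

Lemma series_finite_support (V : normedModType K) (u : V^nat) N :
  (forall n, (N <= n)%N -> u n = 0) -> series u @ \oo --> series u N.
Proof.
move=> u0; apply: cvg_near_cst; exists N => // n /= Nn.
rewrite /series /= (big_cat_nat (n := N))//= [X in _ + X]big1_seq ?addr0// => i.
by rewrite /= mem_index_iota => /andP[Ni _]; exact: u0.
Qed.

End scalars.

(** * Existence of support functionals *)

Section support_exists.
Variables (R : realType) (k : scalars).
Local Notation K := (scalar_field R k).
Local Notation ofR := (@of_real R k).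

(** In the complex case a real-linear f is the real part of F(x) = f(x) - i f(i x). *)
Lemma exists_linear_real_part (V : lmodType K) (f : V -> R) :
    {morph f : x y / x + y} -> (forall t x, f (ofR t *: x) = t * f x) ->
  exists2 F : V -> K^o, linear F & forall x, real_part (F x) = f x.
Proof.
case: k V f => V f fD fZ; first by exists f => // a x y; rewrite fD fZ.
have f0 : f 0 = 0 by have := fZ 0 0; rewrite mul0r scaler0.
have fN x : f (- x) = - f x by apply/eqP; rewrite -addr_eq0 -fD addNr f0.
pose i : scalar_field R ComplexScalars := 'i%C.
exists (fun x => (f x -i* f (i *: x))%C) => // -[a b] x y.
(* As f is homogeneous for real scalars only, a complex scaling is split into real ones and a
   multiplication by i. *)
have E v : (a +i* b)%C *: v = of_real ComplexScalars a *: v +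
    of_real ComplexScalars b *: (i *: v) :> V.
  rewrite scalerA -scalerDl; congr (_ *: _).
  by apply/eqP; rewrite eq_complex /=; apply/andP; split; apply/eqP; rewrite /=; ring.
have ii v : i *: (i *: v) = - v :> V.
  by rewrite scalerA -scaleN1r; congr (_ *: _); exact: sqr_i.
rewrite scalerDr [i *: (_ *: x)]scalerA [i * _]mulrC -scalerA !fD !E !fD !fZ ii fN.
apply/eqP; rewrite eq_complex /=; apply/andP; split; apply/eqP; rewrite /=; ring.
Qed.

Variable V : normedModType K.

Lemma rnorm_sublinear : sublinear (@rnorm R k V).
Proof.
split=> [|t x t0]; first exact: rnormD.
by rewrite rnormZ rnorm_of_real.
Qed.

(** The value |x| at a non-zero x already forces the norm to be at least 1. *)
Lemma support_functionalsP (x : V) (f : dual V) : x != 0 ->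
  support_functionals x f <-> dual_rnorm f <= 1 /\ f x = `|x|.
Proof.
move=> x0; split=> [[f1 fx]|[f1 fx]]; split => //.
  by rewrite -(of_realK (R := R) k (dual_rnorm f)) -dual_normE f1 -(of_real1 R k) of_realK.
rewrite dual_normE -(of_real1 R k); congr ofR.
apply/eqP; rewrite eq_le f1 /=.
rewrite -(ler_pM2r (rnorm_gt0 x0)) mul1r; apply: le_trans (dual_le f x).
by rewrite fx /rnorm normr_id.
Qed.

Lemma support_functionals_nonempty (x : V) : x != 0 -> support_functionals x !=set0.
Proof.
move=> x0.
(* The dominating functional is the norm linearized along x: this retains f(y) <= |y| and also
   forces f(x) >= |x|. *)
have sl := linearize_at_sublinear x rnorm_sublinear.
have [f [fD fZ fle]] := sublinear_dominates_linear sl.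
have lle y t := @linearize_at_le _ _ _ _ x rnorm_sublinear y t.
have f_le y : f y <= rnorm y.
  apply: le_trans (fle y) _; have := lle y 0 (lexx _).
  by rewrite of_real0 scale0r addr0 mul0r subr0.
have f0 : f 0 = 0 by have := fZ 0 0; rewrite mul0r scaler0.
have f_x : rnorm x <= f x.
  (* At -x with t = 1 the bound is |-x + x| - |x| = -|x|. *)
  have := le_trans (fle (- x)) (lle (- x) 1 ler01).
  rewrite of_real1 scale1r mul1r addNr rnorm0 sub0r.
  suff -> : f (- x) = - f x by rewrite lerN2.
  by apply/eqP; rewrite -addr_eq0 -fD addNr f0.
have [F Flin Ff] := exists_linear_real_part fD fZ.
have Fle y : rnorm (F y) <= rnorm y.
  (* Rotating F(y) onto the nonnegative reals gives |F(y)| = Re F(u y) = f(u y) <= |y|. *)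
  have [u u1 uF] := exists_phase (F y).
  have -> : rnorm (F y) = f (u *: y).
    by rewrite -Ff (GRing.scalable_linear Flin u y : _ = u * F y) uF.
  by apply: le_trans (f_le _) _; rewrite rnormZ u1 mul1r.
have Fdual : F \in @dual_pred R k V.
  by apply: (bounded_in_dual (M := 1)) => // y; rewrite mul1r.
exists (Dual Fdual); apply/support_functionalsP => //; split.
  by apply: dual_rnorm_le => // y; rewrite mul1r.
by rewrite -rnormE; apply: eq_of_real => //=; rewrite Ff.
Qed.

End support_exists.

(** * Duality of the direct sums *)

Section direct_sum_duality.
Variables (R : realType) (k : scalars) (X : nat -> normedModType (scalar_field R k)).
Local Notation K := (scalar_field R k).
Local Notation ofR := (@of_real R k).
Local Notation X' := (fun n => dual (X n)).

Lemma eq_norm_rnorm (V W : normedModType K) (v : V) (w : W) :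
  `|v| = `|w| <-> rnorm v = rnorm w.
Proof. by rewrite -!rnormE; split => [/(can_inj (@of_realK R k))|->]. Qed.

Lemma rnorm_dual (V : normedModType K) (g : dual V) : rnorm g = dual_rnorm g.
Proof. exact: of_realK. Qed.

(** * Sequences of finite support, used as test vectors *)

Section finite_support.
Variables (x : seq_product X) (N : nat).
Hypothesis x0 : forall n, (N <= n)%N -> x n = 0.

Let term_norms_eq0 n : (N <= n)%N -> term_norms x n = 0.
Proof. by move=> /x0 xn; rewrite /term_norms xn rnorm0. Qed.

Lemma finite_support_l1 : x \in @l1_pred R k X.
Proof.
rewrite inE; apply/cvgP.
exact: (series_finite_support (k := RealScalars) term_norms_eq0).
Qed.

Lemma finite_support_c0 : x \in @c0_pred R k X.
Proof. by rewrite inE; apply: cvg_near_cst; exists N. Qed.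

Lemma pairing_finite_support (f : seq_product X') :
  pairing f x = series (fun n => f n (x n)) N.
Proof.
apply/cvg_lim; first exact: norm_hausdorff.
by apply: series_finite_support => n /x0 ->; rewrite linear0.
Qed.

Lemma l1_rnorm_finite_support (xl1 : x \in @l1_pred R k X) :
  l1_rnorm (L1Sum xl1) = series (term_norms x) N.
Proof.
apply/cvg_lim; first exact: norm_hausdorff.
exact: (series_finite_support (k := RealScalars) term_norms_eq0).
Qed.

End finite_support.

(** The functional is tested on the sequence with the single entry v at position n. *)
Lemma dual_rnorm_le_linfty_functional (f : linfty_sum X') n :
  dual_rnorm (f n) <= dual_rnorm (linfty_functional f).
Proof.
apply: dual_rnorm_le => [|v]; first exact: dual_rnorm_ge0.
pose x : seq_product X := dfwith (fun m => 0 : X m) v.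
have xn : x n = v by exact: dfwith_in.
have xm m : n != m -> x m = 0 by exact: dfwith_out.
have x0 m : (n.+1 <= m)%N -> x m = 0 by move=> nm; rewrite xm// ltn_eqF.
have := dual_le (linfty_functional f) (L1Sum (finite_support_l1 x0)).
rewrite [X in rnorm X]/= (pairing_finite_support x0).
rewrite [rnorm (L1Sum _)](of_realK k) (l1_rnorm_finite_support x0).
rewrite /series /= !big_nat_recr//= !big1_seq ?add0r/=.
- by rewrite /term_norms xn.
- by move=> i; rewrite mem_index_iota/= => /gtn_eqF ni; rewrite /term_norms xm ?rnorm0// ni.
- by move=> i; rewrite mem_index_iota/= => /gtn_eqF ni; rewrite xm ?linear0// ni.
Qed.

Lemma dual_rnorm_linfty_functional (f : linfty_sum X') :
  dual_rnorm (linfty_functional f) = linfty_rnorm f.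
Proof.
apply/eqP; rewrite eq_le; apply/andP; split.
  apply: dual_rnorm_le => [|x]; last by case: (linfty_l1_le f x).
  exact: le_trans (rnorm_ge0 _) (linfty_rnorm_ge f 0).
apply: ge_sup; first by exists (term_norms f 0%N), 0%N.
by move=> _ [n _ <-]; rewrite /term_norms rnorm_dual dual_rnorm_le_linfty_functional.
Qed.

(** The norm need not be attained, hence the factor t < 1. A phase makes the value real, so that
    such values add up without cancellation. *)
Lemma exists_almost_norming (V : normedModType K) (g : dual V) (t : R) : t < 1 ->
  exists v : V, rnorm v <= 1 /\ exists2 r : R, t * dual_rnorm g <= r & g v = ofR r.
Proof.
move=> t1; have [g0|g0] := eqVneq (dual_rnorm g) 0.
  by exists 0; split; [rewrite rnorm0|exists 0; rewrite ?g0 ?mulr0// linear0 of_real0].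
have : t * dual_rnorm g < dual_rnorm g.
  by rewrite gtr_pMl// lt0r g0 dual_rnorm_ge0.
case/sup_gt => [|_ [v /= v1 <-] /ltW tv]; first by exists (rnorm (g 0)), 0; rewrite /= ?rnorm0.
have [u u1 ug] := exists_phase (g v).
exists (u *: v); split; first by rewrite rnormZ u1 mul1r.
by exists (rnorm (g v)) => //; rewrite linearZ/= rnormE -ug.
Qed.

Lemma dual_rnorm_l1_functional (f : l1_sum X') :
  dual_rnorm (l1_functional f) = l1_rnorm f.
Proof.
apply/eqP; rewrite eq_le; apply/andP; split.
  apply: dual_rnorm_le => [|x]; last by case: (l1_c0_le f x).
  exact: le_trans (rnorm_ge0 _) (l1_rnorm_ge f 0).
apply: limr_le; first exact: l1_cvg.
apply: nearW => N; set M := dual_rnorm _; set S := series _ N.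
have M0 : 0 <= M by exact: dual_rnorm_ge0.
suff tSM t : t < 1 -> t * S <= M.
  rewrite leNgt; apply/negP => MS; have S0 : 0 < S by exact: le_lt_trans MS.
  (* For this t the product t S is the midpoint of M and S, which exceeds M. *)
  have : (M + S) / 2 / S < 1 by rewrite ltr_pdivrMr//; lra.
  by move=> /tSM; rewrite divfK ?gt_eqF//; lra.
(* The test vector has almost norming entries in the first N places and zeros after, so its norm is
   at most 1. *)
move=> t1; pose v n := sval (cid (exists_almost_norming (f n) t1)).
have vP n := svalP (cid (exists_almost_norming (f n) t1)).
pose x : seq_product X := fun n => if (n < N)%N then v n else 0.
have x0 n : (N <= n)%N -> x n = 0.
  by rewrite leqNgt /seq_term /x => /negbTE ->.
pose y := C0Sum (finite_support_c0 x0).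
have y1 : rnorm y <= 1.
  rewrite [rnorm y](of_realK k); apply: ge_sup; first by exists (term_norms x 0%N), 0%N.
  move=> _ [n _ <-]; rewrite /term_norms /seq_term /= /x.
  by case: ifP => _; [exact: (vP n).1|rewrite rnorm0].
have r n : exists r, (n < N)%N -> t * dual_rnorm (f n) <= r /\ f n (x n) = ofR r.
  by have [_ [r tr fr]] := vP n; exists r => nN; rewrite /seq_term /x nN.
have {r} [r rP] := choice r.
have fy : pairing f y = ofR (series r N).
  rewrite (pairing_finite_support x0) -[RHS](congr1 (fun u => u N) (series_of_real k r)).
  rewrite /series /= !big_mkord; apply: eq_bigr => i _; exact: (rP i (ltn_ord i)).2.
have Sr : t * S <= series r N.
  rewrite /S /series /= mulr_sumr !big_mkord; apply: ler_sum => i _.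
  by rewrite /term_norms rnorm_dual; exact: (rP i (ltn_ord i)).1.
have rM : series r N <= rnorm (l1_functional f y).
  rewrite /= fy; apply: le_trans (real_part_le_rnorm _).
  by rewrite of_realK ler_norm.
apply: le_trans Sr (le_trans rM _); apply: le_trans (dual_le _ _) _.
by rewrite ler_piMr.
Qed.

(** The bound N makes [A] finite, so the sum over [A] is a true sum and not the default 0 of an
    infinite support. *)
Lemma limn_series_fsbig (A : set nat) (u : R^nat) N :
    (forall n, (N <= n)%N -> ~ A n) -> (forall n, ~ A n -> u n = 0) ->
  limn (series u) = \sum_(n \in A) u n.
Proof.
move=> NA Au.
have -> : limn (series u) = series u N.
  apply/cvg_lim; first exact: norm_hausdorff.
  by apply: (series_finite_support (k := RealScalars)) => n /NA/Au.
rewrite /series /= big_mkord fsbig_ord; apply/esym/fsbig_widen.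
  by move=> n An /=; rewrite ltnNge; apply/negP => /NA.
by move=> n [_ /Au].
Qed.

Lemma l1_support_functionals (x : l1_sum X) (f : linfty_sum X') : x != 0 ->
  support_functionals x (linfty_functional f) <->
  forall n, (x n != 0 -> support_functionals (x n) (f n)) /\
            (x n = 0 -> `|f n| <= 1).
Proof.
move=> /support_functionalsP ->; rewrite dual_rnorm_linfty_functional.
have norm_le1 n : (`|f n| <= 1) = (dual_rnorm (f n) <= 1).
  by rewrite dual_normE -(of_real1 R k) ler_of_real.
split=> [[f1 fx] n|fP].
  have fn1 m : dual_rnorm (f m) <= 1.
    by rewrite -rnorm_dual; exact: le_trans (linfty_rnorm_ge f m) f1.
  split=> [xn0|_]; last by rewrite norm_le1.
  apply/support_functionalsP => //; split => //.
  (* Equality holds throughout |sum f_m(x_m)| <= sum |x_m|, hence in each term. *)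
  rewrite -rnormE; apply: (@series_eq_of_real _ _ (fun n => f n (x n)) (term_norms x)).
  - move=> m; apply: le_trans (dual_le _ _) _.
    by rewrite ler_piMl ?rnorm_ge0.
  - by case: (linfty_l1_le f x).
  - exact: l1_cvg.
  - by move: fx; rewrite /= /pairing => ->; rewrite l1_normE of_realK.
(* Both cases merge, since f_n(x_n) = |x_n| is trivial at x_n = 0. *)
have {}fP n : dual_rnorm (f n) <= 1 /\ f n (x n) = `|x n|.
  have [xn0|xn0] := eqVneq (x n) 0.
    by rewrite -norm_le1 (fP n).2// xn0 linear0 normr0.
  by apply/(support_functionalsP _ xn0)/(fP n).1.
split.
  apply: ge_sup; first by exists (term_norms f 0%N), 0%N.
  by move=> _ [n _ <-]; rewrite /term_norms rnorm_dual (fP n).1.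
rewrite /= /pairing l1_normE -lim_series_of_real; last exact: l1_cvg.
by congr (limn (series _)); apply/funext => n; rewrite (fP n).2 -rnormE.
Qed.

Lemma c0_support_functionals (x : c0_sum X) (f : l1_sum X') : x != 0 ->
  support_functionals x (l1_functional f) <->
  exists lam : nat -> R,
    [/\ forall n, `|x n| = `|x| ->
          0 <= lam n /\
          [set ofR (lam n) *: g | g in support_functionals (x n)] (f n),
        forall n, `|x n| != `|x| -> f n = 0
      & \sum_(n \in [set n | `|x n| = `|x|]) lam n = 1].
Proof.
move=> x_neq0; rewrite support_functionalsP// dual_rnorm_l1_functional.
set A := [set n | _]; set c := c0_rnorm x.
have xc : rnorm x = c by exact: of_realK.
have c0 : 0 < c by rewrite -xc rnorm_gt0.
have AE n : A n <-> rnorm (x n) = c by rewrite -xc; exact: eq_norm_rnorm.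
have A_neq0 n : A n -> x n != 0.
  by move=> /AE xnc; apply: contraTneq c0 => xn0; rewrite -xnc xn0 rnorm0 ltxx.
(* The norms |x_n| tend to 0 while c > 0, so c is attained only finitely often. *)
have [N NA] : exists N, forall n, (N <= n)%N -> ~ A n.
  have [N _ xN] := (@cvgrPdist_lt _ _ _ _ _ _ _).1 (@c0_cvg _ _ _ x) _ c0.
  exists N => n /xN /=; rewrite sub0r normrN ger0_norm ?rnorm_ge0// => xnc /AE.
  by move/eqP; rewrite lt_eqF.
(* The termwise bounds |f_n(x_n)| <= c |f_n| have the sum c |f|. *)
pose v : R^nat := fun n => c * dual_rnorm (f n).
have v_series : series v @ \oo --> c * l1_rnorm f.
  have -> : v = c *: term_norms f.
    by apply/funext => n; rewrite /v -rnorm_dual.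
  rewrite -[c * _](lim_seriesZ c (@l1_cvg _ _ _ f)).
  by apply: is_cvg_seriesZ; exact: l1_cvg.
have v_lim : limn (series v) = c * l1_rnorm f by exact/cvg_lim.
have sum_lam : (forall n, ~ A n -> f n = 0) ->
    l1_rnorm f = \sum_(n \in A) dual_rnorm (f n).
  move=> fA; rewrite -(limn_series_fsbig NA) => [|n /fA ->].
    by congr (limn (series _)); apply/funext => n; exact: rnorm_dual.
  by rewrite -rnorm_dual rnorm0.
have lim_of_real : (forall n, f n (x n) = ofR (v n)) ->
    pairing f x = ofR (c * l1_rnorm f).
  move=> fxv; rewrite -v_lim -lim_series_of_real; last exact: cvgP v_series.
  by congr (limn (series _)); apply/funext => n; exact: fxv.
split=> [[f1 fx]|[lam [lamA fA lam1]]].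
  have fxv : forall n, f n (x n) = ofR (v n).
    apply: (@series_eq_of_real _ _ (fun n => f n (x n)) v) => [n|||].
    - apply: le_trans (dual_le _ _) _.
      by rewrite mulrC ler_wpM2r ?dual_rnorm_ge0// c0_rnorm_ge.
    - by case: (l1_c0_le f x).
    - exact: cvgP v_series.
    - move: fx; rewrite /= /pairing => ->; rewrite c0_normE of_realK v_lim.
      by rewrite ler_piMr// ltW.
  have fA n : ~ A n -> f n = 0.
    move=> nA; apply: rnorm0_eq0; rewrite rnorm_dual; apply/eqP.
    have xnc : rnorm (x n) < c.
      by rewrite lt_neqAle c0_rnorm_ge andbT; apply/eqP => /AE.
    (* Here c |f_n| = |f_n(x_n)| <= |f_n| |x_n| with |x_n| < c, which forces |f_n| = 0. *)
    have := dual_le (f n) (x n).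
    rewrite fxv rnorm_of_real ?mulr_ge0 ?dual_rnorm_ge0 ?(ltW c0)//.
    rewrite [v n]mulrC -subr_le0 -mulrBr pmulr_lle0 ?subr_gt0// => fn0.
    by rewrite eq_le fn0 dual_rnorm_ge0.
  exists (fun n => dual_rnorm (f n)); split=> [n An|n /eqP|]; last 2 first.
  - exact: fA.
  (* Multiplied by c, the sum of the weights is the value f(x) = c. *)
  - rewrite -sum_lam//; apply: (mulfI (lt0r_neq0 c0)); rewrite mulr1.
    apply: (can_inj (@of_realK R k)).
    by rewrite -lim_of_real//; move: fx => /= ->; rewrite c0_normE.
  split; first exact: dual_rnorm_ge0.
  have xn0 := A_neq0 n An.
  (* A zero f_n is 0 times any support functional of x_n; a non-zero one is normalized. *)
  have [fn0|fn0] := eqVneq (f n) 0.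
    have [g gx] := support_functionals_nonempty xn0.
    by exists g => //; rewrite -rnorm_dual fn0 rnorm0 of_real0 scale0r.
  have ln0 : ofR (dual_rnorm (f n)) != 0 by rewrite -dual_normE normr_eq0.
  exists ((ofR (dual_rnorm (f n)))^-1 *: f n); last by rewrite scalerA divff// scale1r.
  split; first by rewrite normrZ normfV -dual_normE normr_id mulVf// normr_eq0.
  move/AE: An => xnc.
  rewrite -[LHS]/(_^-1 * f n (x n)) fxv -rnormE xnc /v of_realM mulrCA mulVf//.
  by rewrite mulr1.
have {}fA n : ~ A n -> f n = 0 by move=> nA; apply: fA; exact/eqP.
(* From f_n = lambda_n g with |g| = 1 and lambda_n >= 0 follow |f_n| = lambda_n and f_n(x_n) =
   lambda_n c. *)
have lamE n : A n -> dual_rnorm (f n) = lam n /\ f n (x n) = ofR (v n).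
  move=> An; have [l0 [g [g1 gx] fg]] := lamA n An.
  have fl : dual_rnorm (f n) = lam n.
    by rewrite -rnorm_dual -fg rnormZ rnorm_of_real// /rnorm g1 -(of_real1 R k) of_realK mulr1.
  split => //; rewrite /v fl -fg -[LHS]/(_ * g (x n)) gx -rnormE.
  by move/AE: An => ->; rewrite -of_realM mulrC.
have l1 : l1_rnorm f = 1.
  rewrite sum_lam// -lam1; apply: eq_fsbigr => n.
  by rewrite inE => /lamE[].
split; first by rewrite l1.
rewrite /= lim_of_real ?l1 ?mulr1// => n.
have [/lamE[]//|/fA fn0] := pselect (A n).
by rewrite /v -rnorm_dual fn0 rnorm0 mulr0 of_real0.
Qed.

End direct_sum_duality.

(* In the second part the weights are nonnegative rather than positive: for
   x = (1, 1, 0, ...) and f = (1, 0, 0, ...) over X_n = R, f is a support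
   functional of x although its coordinate f_1 vanishes and |x_1| = |x|. *)
Theorem theorem14 (R : realType) (k : scalars)
    (X : nat -> normedModType (scalar_field R k))
    (X_nontrivial : forall n, exists v : X n, v != 0) :
  (forall (x : l1_sum X) (f : linfty_sum (fun n => dual (X n))), x != 0 ->
     (support_functionals x (linfty_functional f) <->
      forall n, (x n != 0 -> support_functionals (x n) (f n)) /\
                (x n = 0 -> `|f n| <= 1)))
  /\
  (forall (x : c0_sum X) (f : l1_sum (fun n => dual (X n))), x != 0 ->
     (support_functionals x (l1_functional f) <->
      exists lam : nat -> R,
        [/\ forall n, `|x n| = `|x| ->
              0 <= lam n /\
              [set of_real k (lam n) *: g | g in support_functionals (x n)] (f n),
            forall n, `|x n| != `|x| -> f n = 0
          & \sum_(n \in [set n | `|x n| = `|x|]) lam n = 1])).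
Proof.
by split => x f; [exact: l1_support_functionals|exact: c0_support_functionals].
Qed.
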